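(* Consider the closed-loop SMP system $x_{t+1}=(A_t(\theta_t)-B_t(\theta_t)K)x_t$ with feedback gain $K\in\mathbb{R}^{m\times n}$ and its expanded system $\tilde x_{t+1}=\mathcal{C}(F(\tilde\theta_t,K))\tilde x_t$ (both defined in the context). Let $x_0\in\mathbb{R}^n$ and $\theta_t\in\mathbb{S}_\theta$ for $t\in\{0,1,2,\dots\}$ be arbitrary, and suppose $$\tilde x_0=\mathrm{vech}(x_0x_0^\top),\qquad \tilde\theta_t=\phi(\theta_t)\ \text{ for all } t.$$ Then for all $t\in\{0,1,2,\dots\}$, $$\tilde x_t=\mathrm{E}\big[\mathrm{vech}(x_tx_t^\top)\,\big|_{\theta_\bullet}\big].$$
   Context: Let $n,m,d_\theta$ be positive integers and $\mathbb{S}_\theta\subset\mathbb{R}^{d_\theta}$. Consider $x_{t+1}=A_t(\theta_t)x_t+B_t(\theta_t)u_t$, $t=0,1,2,\dots$, with state $x_t\in\mathbb{R}^n$, input $u_t\in\mathbb{R}^m$, deterministic initial state $x_0$, and uncertain parameters $\theta_t\in\mathbb{S}_\theta$ (deterministic or stochastic, unknown). The random vector $v_t(\theta_t):=\mathrm{vec}([A_t(\theta_t),B_t(\theta_t)])\in\mathbb{R}^{n(n+m)}$ has a Lebesgue-measurable conditional density $p(v_t\mid\theta_t)$, and for every $s\ge1$ the conditional density of $(v_0,\dots,v_s)$ given the sequence $(\theta_0,\theta_1,\dots)$ equals $\prod_{t=0}^s p(v_t\mid\theta_t)$. $\mathrm{E}[\cdot\,|_{\theta_\bullet}]$ denotes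 conditional expectation given the sequence $(\theta_0,\theta_1,\dots)$. Here $\mathrm{vec}$ stacks the columns of a matrix, and $\mathrm{vech}(X)$ stacks, column by column, the entries on and below the diagonal of a square matrix $X$. Let $\mathbb{P}_N:=\{\varphi\in\mathbb{R}^N:\varphi_k\ge0,\ \sum_k\varphi_k=1\}$. The system is assumed second moment polytopic (SMP): there are a positive integer $N$, symmetric $M^{(1)},\dots,M^{(N)}\in\mathbb{R}^{n(n+m)\times n(n+m)}$ and a map $\phi:\mathbb{S}_\theta\to\mathbb{P}_N$ with $\mathrm{E}[v_t(\theta_t)v_t(\theta_t)^\top|_{\theta_\bullet}]=\sum_{k=1}^N[\phi(\theta_t)]_kM^{(k)}$ for all $t$ and all sequences $\theta_0,\theta_1,\dots\in\mathbb{S}_\theta$. With $u_t=-Kx_t$ the closed loop is $x_{t+1}=(A_t(\theta_t)-B_t(\theta_t)K)x_t$. Expanded system: let $\tilde n=n(n+1)/2$; let $E_e\in\mathbb{R}^{\tilde n\times n^2}$ satisfy $E_e\mathrm{vec}(X)=\mathrm{vech}(X)$ for all $X\in\mathbb{R}^{n\times n}$ and $D\in\mathbb{R}^{n^2\times\tilde n}$ satisfy $D\,\mathrm{vech}(Y)=\mathrm{vec}(Y)$ for all symmetric $Y\in\mathbb{R}^{n\times n}$; set $\mathcal{C}(Y):=E_eYD$ for $Y\in\mathbb{R}^{n^2\times n^2}$. Partition $M^{(k)}$ into $(n+m)\times(n+m)$ blocks $M^{(k)}_{i,j}\in\mathbb{R}^{n\times n}$. Define $F^{(k)}_{aa}\in\mathbb{R}^{n^2\times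 n^2}$, $F^{(k)}_{ab},F^{(k)}_{ba}\in\mathbb{R}^{n^2\times nm}$, $F^{(k)}_{bb}\in\mathbb{R}^{n^2\times m^2}$ columnwise by: column $n(j-1)+i$ of $F^{(k)}_{aa}$ is $\mathrm{vec}(M^{(k)}_{i,j})$; column $m(j-1)+i'$ of $F^{(k)}_{ab}$ is $\mathrm{vec}(M^{(k)}_{n+i',j})$; column $n(j'-1)+i$ of $F^{(k)}_{ba}$ is $\mathrm{vec}(M^{(k)}_{i,n+j'})$; column $m(j'-1)+i'$ of $F^{(k)}_{bb}$ is $\mathrm{vec}(M^{(k)}_{n+i',n+j'})$, for $i,j\in\{1,\dots,n\}$, $i',j'\in\{1,\dots,m\}$. Let $F^{(k)}(K):=F^{(k)}_{aa}-F^{(k)}_{ab}(I_n\otimes K)-F^{(k)}_{ba}(K\otimes I_n)+F^{(k)}_{bb}(K\otimes K)$ and $F(\tilde\theta,K):=\sum_{k=1}^N[\tilde\theta]_kF^{(k)}(K)$. The expanded system is $\tilde x_{t+1}=\mathcal{C}(F(\tilde\theta_t,K))\tilde x_t$ with $\tilde x_t\in\mathbb{R}^{\tilde n}$, $\tilde\theta_t\in\tilde{\mathbb{S}}:=\{\phi(\theta):\theta\in\mathbb{S}_\theta\}$. *)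

(* Defs.v *)
From HB Require Import structures.
From mathcomp Require Import all_boot all_order all_algebra.
From mathcomp Require Import all_classical all_reals all_analysis.
Set Implicit Arguments. Unset Strict Implicit. Unset Printing Implicit Defensive.
Import Order.TTheory GRing.Theory Num.Theory.
Local Open Scope ring_scope.
Local Open Scope classical_set_scope.

Section Defs.
Variable R : realType.

(* Index convention: for (i : 'I_p) (j : 'I_q), mxvec_index i j is the
   0-based position p-major, i.e. (i * q + j). *)

(* vec X : column stacking of X : p x q; entry (i,j) of X sits at position
   j*p + i = mxvec_index j i (0-based), i.e. n(j-1)+i in 1-based notation. *)
Definition vec {p q : nat} (X : 'M[R]_(p, q)) : 'cV[R]_(q * p) := (mxvec X^T)^T.

Definition vech_dim (n : nat) : nat := (n * n.+1) %/ 2.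
Definition vech_seq {n : nat} (X : 'M[R]_n) : seq R :=
  flatten [seq [seq X i j | i : 'I_n <- enum 'I_n & (j <= i)%N] | j : 'I_n <- enum 'I_n].
Definition vech {n : nat} (X : 'M[R]_n) : 'cV[R]_(vech_dim n) :=
  \col_(k < vech_dim n) nth 0 (vech_seq X) k.

(* Kronecker product: (A (x) B) (i*c + k, j*d + l) = A i j * B k l. *)
Definition kron {a b c d : nat} (A : 'M[R]_(a, b)) (B : 'M[R]_(c, d))
  : 'M[R]_(a * c, b * d) :=
  (\matrix_(s < b * d) mxvec (\matrix_(i < a, k < c)
      (mxvec (\matrix_(j < b, l < d) (A i j * B k l))) 0 s))^T.

(* Matrix whose column with index mxvec_index j i (= j*p + i, 0-based) is G i j. *)
Definition colstack {r p q : nat} (G : 'I_p -> 'I_q -> 'cV[R]_r) : 'M[R]_(r, q * p) :=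
  \matrix_(a < r) mxvec (\matrix_(j < q, i < p) G i j a 0).

(* Block (i,j) (of size n x n) of a matrix of size ((n+m)*n) partitioned
   into (n+m) x (n+m) blocks; the row index of entry a of block-row i is
   n*i + a = mxvec_index i a. *)
Definition blk {n m : nat} (M : 'M[R]_((n + m) * n)) (i j : 'I_(n + m)) : 'M[R]_n :=
  \matrix_(a < n, b < n) M (mxvec_index i a) (mxvec_index j b).

Definition Faa {n m : nat} (M : 'M[R]_((n + m) * n)) : 'M[R]_(n * n, n * n) :=
  colstack (fun (i j : 'I_n) => vec (blk M (lshift m i) (lshift m j))).
Definition Fab {n m : nat} (M : 'M[R]_((n + m) * n)) : 'M[R]_(n * n, n * m) :=
  colstack (fun (i' : 'I_m) (j : 'I_n) => vec (blk M (rshift n i') (lshift m j))).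
Definition Fba {n m : nat} (M : 'M[R]_((n + m) * n)) : 'M[R]_(n * n, m * n) :=
  colstack (fun (i : 'I_n) (j' : 'I_m) => vec (blk M (lshift m i) (rshift n j'))).
Definition Fbb {n m : nat} (M : 'M[R]_((n + m) * n)) : 'M[R]_(n * n, m * m) :=
  colstack (fun (i' : 'I_m) (j' : 'I_m) => vec (blk M (rshift n i') (rshift n j'))).

Definition FK {n m : nat} (M : 'M[R]_((n + m) * n)) (K : 'M[R]_(m, n)) : 'M[R]_(n * n) :=
  Faa M - Fab M *m kron 1%:M K - Fba M *m kron K 1%:M + Fbb M *m kron K K.

Definition Fth {n m N : nat} (Ms : 'I_N -> 'M[R]_((n + m) * n))
  (th : 'rV[R]_N) (K : 'M[R]_(m, n)) : 'M[R]_(n * n) :=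
  \sum_(k < N) th 0 k *: FK (Ms k) K.

Definition Cmap {n : nat} (Ee : 'M[R]_(vech_dim n, n * n)) (D : 'M[R]_(n * n, vech_dim n))
  (Y : 'M[R]_(n * n)) : 'M[R]_(vech_dim n) := Ee *m Y *m D.

Definition simplex (N : nat) : set 'rV[R]_N :=
  [set w | (forall k, 0 <= w 0 k) /\ \sum_(k < N) w 0 k = 1].

Definition sigma_of_mx {d} {T : measurableType d} {p q : nat}
  (X : T -> 'M[R]_(p, q)) : set_system T :=
  <<s [set E | exists (i : 'I_p) (j : 'I_q) (B : set R),
                 measurable B /\ E = (fun w => X w i j) @^-1` B] >>.

Definition mutually_independent {d} {T : measurableType d}
  (P : probability T R) (G : nat -> set_system T) : Prop :=
  (forall t, G t `<=` measurable) /\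
  forall (S : seq nat) (E : nat -> set T), uniq S ->
    (forall t, t \in S -> G t (E t)) ->
    P (\bigcap_(t in [set t | t \in S]) E t) = (\prod_(t <- S) P (E t))%E.

Definition vAB {n m : nat} (A : 'M[R]_n) (B : 'M[R]_(n, m)) : 'cV[R]_((n + m) * n) :=
  vec (row_mx A B).

End Defs.

(* Main.v *)
(* Write [A_t - B_t K = V_t L] with [V_t = [A_t, B_t]] and [L = [I; -K]].  Then
   x_{t+1} x_{t+1}^T is linear in the products of an entry of V_t (x) V_t with an
   entry of x_t x_t^T.  Since x_t is a function of V_0, ..., V_{t-1}, these two
   factors are independent, so the second moment matrix S_t = E[x_t x_t^T] obeys
   a linear recursion, whose matrix acting on vec S_t is F(phi(theta_t), K).
   As S_t is symmetric, D vech S_t = vec S_t, and the recursion descends to vech. *)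
Require Import Defs.
From HB Require Import structures.
From mathcomp Require Import all_boot all_order all_algebra.
From mathcomp Require Import all_classical all_reals all_analysis.
From mathcomp Require Import measurable_realfun.
Set Implicit Arguments. Unset Strict Implicit. Unset Printing Implicit Defensive.
Import Order.TTheory GRing.Theory Num.Theory.
Local Open Scope ring_scope.
Local Open Scope classical_set_scope.

(** * Index calculus for [vec], Kronecker products and the matrices [FK] *)

Lemma sum_mxvec_index (V : nmodType) (m n : nat) (f : 'I_(m * n) -> V) :
  \sum_s f s = \sum_i \sum_j f (mxvec_index i j).
Proof.
rewrite pair_bigA (reindex _ (curry_mxvec_bij m n)) /=.
by apply: eq_bigr => -[i j] _.
Qed.

Section Algebra.
Variable R : realType.

Lemma vec_index p q (X : 'M[R]_(p, q)) i j : vec X (mxvec_index j i) 0 = X i j.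
Proof. by rewrite mxE mxvecE mxE. Qed.

Lemma vecP p q (u v : 'cV[R]_(q * p)) :
  (forall i j, u (mxvec_index j i) 0 = v (mxvec_index j i) 0) -> u = v.
Proof.
move=> uv; apply/matrixP => s k; rewrite ord1.
by case/mxvec_indexP: s => j i; exact: uv.
Qed.

Lemma kron_index a b c d (X : 'M[R]_(a, b)) (Y : 'M[R]_(c, d)) i k j l :
  kron X Y (mxvec_index i k) (mxvec_index j l) = X i j * Y k l.
Proof. by rewrite !mxE mxvecE !mxE mxvecE mxE. Qed.

Lemma colstack_vec_index n p q (G : 'I_p -> 'I_q -> 'M[R]_n) a b i j :
  colstack (fun i j => vec (G i j)) (mxvec_index b a) (mxvec_index j i) = G i j a b.
Proof. by rewrite mxE mxvecE mxE vec_index. Qed.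

Definition loop_mx {n m : nat} (K : 'M[R]_(m, n)) : 'M[R]_(n + m, n) :=
  col_mx 1%:M (- K).

Lemma loop_mxE n m (A : 'M[R]_n) (B : 'M[R]_(n, m)) (K : 'M[R]_(m, n)) :
  A - B *m K = row_mx A B *m loop_mx K.
Proof. by rewrite mul_row_col mulmx1 mulmxN. Qed.

(** The four terms of [FK] are the four blocks obtained by splitting p and q at n: the upper block
    of [loop_mx K] is the identity and collapses sums, and each lower factor -K contributes a
    sign. *)
Lemma FK_index n m (M : 'M[R]_((n + m) * n)) (K : 'M[R]_(m, n)) a b i j :
  FK M K (mxvec_index b a) (mxvec_index j i) =
  \sum_p \sum_q loop_mx K p i * loop_mx K q j *
    M (mxvec_index p a) (mxvec_index q b).
Proof.

pose M' p q := M (mxvec_index p a) (mxvec_index q b).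
have delta_suml k (i0 : 'I_k) (f : 'I_k -> R) : \sum_p (p == i0)%:R * f p = f i0.
  rewrite (bigD1 i0) //= eqxx mul1r big1 ?addr0 // => p /negPf ->.
  by rewrite mul0r.
have blkE p q : blk M p q a b = M' p q by rewrite mxE.
have loop_l p k : (loop_mx K) (lshift m p) k = (p == k)%:R.
  by rewrite col_mxEu mxE.
have loop_r p k : (loop_mx K) (rshift n p) k = - K p k.
  by rewrite col_mxEd mxE.
have aaE : Faa M (mxvec_index b a) (mxvec_index j i) = M' (lshift m i) (lshift m j).
  by rewrite colstack_vec_index blkE.
have abE : (Fab M *m kron 1%:M K) (mxvec_index b a) (mxvec_index j i) =
    \sum_p K p i * M' (rshift n p) (lshift m j).
  (* The identity factor of [kron 1%:M K] is matched by writing the right side as a sum against a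
     Kronecker delta. *)
  rewrite mxE sum_mxvec_index -[RHS](delta_suml _ j (fun q =>
    \sum_p K p i * M' (rshift n p) (lshift m q))).
  apply: eq_bigr => q _; rewrite big_distrr; apply: eq_bigr => p _ /=.
  by rewrite colstack_vec_index blkE kron_index mxE mulrC mulrA.
have baE : (Fba M *m kron K 1%:M) (mxvec_index b a) (mxvec_index j i) =
    \sum_q K q j * M' (lshift m i) (rshift n q).
  rewrite mxE sum_mxvec_index; apply: eq_bigr => q _.
  rewrite -[M' (lshift m i) _](delta_suml _ i (fun p => M' (lshift m p) (rshift n q))).
  rewrite big_distrr; apply: eq_bigr => p _ /=.
  by rewrite colstack_vec_index blkE kron_index mxE mulrC mulrA.
have bbE : (Fbb M *m kron K K) (mxvec_index b a) (mxvec_index j i) =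
    \sum_p \sum_q K p i * K q j * M' (rshift n p) (rshift n q).
  rewrite mxE sum_mxvec_index exchange_big /=.
  apply: eq_bigr => p _; apply: eq_bigr => q _.
  by rewrite colstack_vec_index blkE kron_index mulrC (mulrC (K q j)).
have addE (X Y : 'M[R]_(n * n)) s t : (X + Y) s t = X s t + Y s t by rewrite mxE.
have oppE (X : 'M[R]_(n * n)) s t : (- X) s t = - X s t by rewrite mxE.
rewrite /FK !(addE, oppE) aaE abE baE bbE.
(* Both sums are cut at n, leaving one double sum per block. *)
under [RHS]eq_bigr => p _ do rewrite big_split_ord /=.
rewrite big_split big_split_ord [X in _ = _ + X]big_split_ord /=.
have -> : \sum_p \sum_q loop_mx K (lshift m p) i * loop_mx K (lshift m q) j *
    M (mxvec_index (lshift m p) a) (mxvec_index (lshift m q) b) =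
    M' (lshift m i) (lshift m j).
  under eq_bigr => p _.
    under eq_bigr => q _ do rewrite !loop_l -mulrA -/(M' _ _).
    rewrite -big_distrr /= delta_suml.
    over.
  by rewrite delta_suml.
have -> : \sum_p \sum_q loop_mx K (rshift n p) i * loop_mx K (lshift m q) j *
    M (mxvec_index (rshift n p) a) (mxvec_index (lshift m q) b) =
    - \sum_p K p i * M' (rshift n p) (lshift m j).
  rewrite -sumrN; apply: eq_bigr => p _.
  under eq_bigr => q _ do rewrite loop_l loop_r -mulrA -/(M' _ _).
  by rewrite -big_distrr /= delta_suml mulNr.
have -> : \sum_p \sum_q loop_mx K (lshift m p) i * loop_mx K (rshift n q) j *
    M (mxvec_index (lshift m p) a) (mxvec_index (rshift n q) b) =
    - \sum_q K q j * M' (lshift m i) (rshift n q).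
  rewrite -(delta_suml _ i (fun p => - \sum_q K q j * M' (lshift m p) (rshift n q))).
  apply: eq_bigr => p _; rewrite -sumrN big_distrr; apply: eq_bigr => q _ /=.
  by rewrite loop_l loop_r -mulrA mulNr.
have -> : \sum_p \sum_q loop_mx K (rshift n p) i * loop_mx K (rshift n q) j *
    M (mxvec_index (rshift n p) a) (mxvec_index (rshift n q) b) =
    \sum_p \sum_q K p i * K q j * M' (rshift n p) (rshift n q).
  apply: eq_bigr => p _; apply: eq_bigr => q _.
  by rewrite !loop_r mulrNN.
by rewrite !addrA.
Qed.

(** The sums are arranged as in [quadratic_step], so that the two sides correspond term by term,
    with second moments in place of products of entries. *)
Lemma Fth_vec_index n m N (Ms : 'I_N -> 'M[R]_((n + m) * n)) (w : 'rV[R]_N)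
    (K : 'M[R]_(m, n)) (S : 'M[R]_n) a b :
  (Fth Ms w K *m vec S) (mxvec_index b a) 0 =
  \sum_i \sum_j \sum_p \sum_q loop_mx K p i * loop_mx K q j *
    ((\sum_k w 0 k *: Ms k) (mxvec_index p a) (mxvec_index q b) * S i j).
Proof.
rewrite mxE sum_mxvec_index exchange_big /=.
apply: eq_bigr => i _; apply: eq_bigr => j _.
rewrite vec_index /Fth [in LHS]summxE.
under [X in X * _ = _]eq_bigr => k _ do rewrite mxE FK_index.
transitivity (\sum_k \sum_p \sum_q loop_mx K p i * loop_mx K q j *
    (w 0 k * Ms k (mxvec_index p a) (mxvec_index q b) * S i j)).
  rewrite big_distrl; apply: eq_bigr => k _ /=.
  rewrite big_distrr big_distrl; apply: eq_bigr => p _ /=.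
  rewrite big_distrr big_distrl; apply: eq_bigr => q _ /=.
  by rewrite mulrCA -!mulrA.
rewrite exchange_big; apply: eq_bigr => p _ /=.
rewrite exchange_big; apply: eq_bigr => q _ /=.
rewrite -big_distrr -big_distrl /= summxE; congr (_ * (_ * _)).
by apply: eq_bigr => k _; rewrite mxE.
Qed.

End Algebra.

(** * Independence of past and present, and means of products *)

Section Probability.
Context (R : realType) (d : measure_display) (T : measurableType d).
Variable P : probability T R.

(* The "rectangles" [E_0 /\ ... /\ E_{t-1}] with [E_s] in [G s]: a pi-system
   generating the join of the sigma-algebras [G 0], ..., [G (t-1)]. *)
Definition past (G : nat -> set_system T) (t : nat) : set_system T :=
  [set C | exists2 E : nat -> set T, (forall s, G s (E s)) &
     C = \bigcap_(s in [set s | s \in iota 0 t]) E s].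

(** For fixed E, both sides are finite measures in C. They agree on the pi-system [past G t], hence
    on the sigma-algebra it generates. *)
Lemma past_independent (G : nat -> set_system T) (t : nat) (C E : set T) :
  (forall s, G s setT) -> (forall s, setI_closed (G s)) ->
  mutually_independent P G -> <<s past G t >> C -> G t E ->
  P (C `&` E) = (P C * P E)%E.
Proof.
move=> GT GI [Gm Gind] sC GE; have mE := Gm _ _ GE.
have P0 : 0 <= fine (P E) by exact: fine_ge0.
have mscaleE A : mscale (NngNum P0) P A = (P E * P A)%E.
  by rewrite /mscale /= fineK ?fin_num_measure.
suff : mrestr P mE C = mscale (NngNum P0) P C.
  by rewrite mscaleE muleC.
apply: (g_sigma_algebra_measure_unique (past G t) _ (fun=> setT)) sC => //.
- move=> _ [F GF ->]; apply: (@bigcap_measurableType _ T) => s _; exact/Gm/GF.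
- by move=> _; exists (fun=> setT) => //; rewrite bigcapT.
- by rewrite bigcup_const//; exists 0%N.
- move=> _ _ [F GF ->] [F' GF' ->]; exists (fun s => F s `&` F' s).
    by move=> s; exact: GI.
  by rewrite bigcapI.
- move=> _ [F GF ->]; set A := \bigcap_(s in _) _; transitivity (P (A `&` E)); first by [].
  transitivity (P A * P E)%E; last by rewrite muleC -mscaleE.
  rewrite {}/A.
  (* Inserting E at time t makes A [&] E a single intersection over the times 0, ..., t, to which
     mutual independence applies. *)
  pose F' s := if s == t then E else F s.
  have F'F s : s \in iota 0 t -> F' s = F s.
    by rewrite mem_iota /F' => /andP[_ st]; rewrite ltn_eqF.
  have GF' s : G s (F' s) by rewrite /F'; case: eqP => [->|].
  transitivity (P (\bigcap_(s in [set s | s \in iota 0 t.+1]) F' s)).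
    have -> : [set` iota 0 t.+1] = [set` iota 0 t] `|` [set t].
      rewrite -[t.+1]addn1 iotaD; apply/seteqP; split=> s; rewrite /= mem_cat inE.
        by move=> /orP[|/eqP]; [left|right].
      by move=> [->//|->]; rewrite eqxx orbT.
    congr (P _).
    rewrite bigcap_setU bigcap_set1 [F' t]/F' eqxx; congr (_ `&` _).
    by apply: eq_bigcapr => s /= /F'F.
  rewrite !Gind ?iota_uniq//.
  rewrite -[t.+1]addn1 iotaD add0n big_cat big_seq1 /= [F' t]/F' eqxx; congr (_ * _)%E.
  by rewrite big_seq_cond [RHS]big_seq_cond; apply: eq_bigr => s; rewrite andbT => /F'F ->.
- move=> _; apply: (@le_lt_trans _ _ (P (setT `&` E))) => //.
  by rewrite setTI (le_lt_trans (probability_le1 _ _)) ?ltry.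
Qed.

Lemma sub_past (G : nat -> set_system T) (s t : nat) (E : set T) :
  (forall r, G r setT) -> (s < t)%N -> G s E -> past G t E.
Proof.
move=> GT st GE; exists (fun r => if r == s then E else setT).
  by move=> r; case: eqP => [->|].
apply/seteqP; split=> [w Ew r _|w /(_ s)]; first by case: eqP.
by rewrite /= mem_iota eqxx; exact.
Qed.

(** Integrability is bundled with the value because the sum and product rules require it and the
    induction on time must propagate it. *)
Definition has_mean (f : T -> R) (e : R) :=
  P.-integrable setT (EFin \o f) /\ ('E_P[f] = e%:E)%E.

Lemma has_mean_unique (f : T -> R) (a b : R) :
  has_mean f a -> has_mean f b -> a = b.
Proof. by move=> [_ fa] [_]; rewrite fa => -[]. Qed.

Lemma has_mean_cst (c : R) : has_mean (cst c) c.
Proof.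
by split; [exact: finite_measure_integrable_cst|exact: expectation_cst].
Qed.

Lemma has_meanZ (c : R) (f : T -> R) (e : R) :
  has_mean f e -> has_mean (fun w => c * f w) (c * e).
Proof.
move=> [fi]; rewrite /has_mean unlock => fe; split.
  by apply: eq_integrable (integrableZl measurableT c fi) => // w _ /=; rewrite EFinM.
by rewrite EFinM -fe -integralZl.
Qed.

Lemma has_mean_sum (I : finType) (f : I -> T -> R) (e : I -> R) :
  (forall i, has_mean (f i) (e i)) ->
  has_mean (fun w => \sum_i f i w) (\sum_i e i).
Proof.
move=> fe; have fi i : P.-integrable setT (EFin \o f i) by have [] := fe i.
have eqf : EFin \o (fun w => \sum_i f i w) = fun w => (\sum_i (EFin \o f i) w)%E.
  by apply/funext => w /=; rewrite -sumEFin.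
split; first by rewrite eqf; exact: integrable_sum.
rewrite unlock -[X in integral _ _ X]/(EFin \o _) eqf integral_sum// -sumEFin.
by apply: eq_bigr => i _; have [_] := fe i; rewrite unlock.
Qed.

(** By independence the law of the pair (f, g) is the product of the two laws, and Fubini factors
    the integral of xy. *)
Lemma has_mean_mul (f g : T -> R) (a b : R) :
  (forall B C, measurable B -> measurable C ->
    P (f @^-1` B `&` g @^-1` C) = P (f @^-1` B) * P (g @^-1` C))%E ->
  has_mean f a -> has_mean g b -> has_mean (f \* g) (a * b).
Proof.
move=> fg [fi Ef] [gi Eg].
have mf : measurable_fun setT f by exact/measurable_EFinP/(measurable_int _ fi).
have mg : measurable_fun setT g by exact/measurable_EFinP/(measurable_int _ gi).
pose X : {RV P >-> R} := HB.pack f (isMeasurableFun.Build _ _ _ _ f mf).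
pose Y : {RV P >-> R} := HB.pack g (isMeasurableFun.Build _ _ _ _ g mg).
pose h w := (f w, g w).
have mh : measurable_fun setT h by exact: measurable_fun_pair.
pose hM : {mfun T >-> (R * R)%type} := HB.pack h (isMeasurableFun.Build _ _ _ _ h mh).
(* Agreement on rectangles, which is the independence hypothesis, determines the product measure. *)
have lawE A : measurable A ->
    (distribution P X \x distribution P Y)%E A = distribution P hM A.
  apply: product_measure_unique => B C mB mC; rewrite /distribution /= /pushforward.
  exact: fg.
pose p (z : R * R) := (z.1 * z.2)%:E.
have mp : measurable_fun setT p.
  apply/measurable_EFinP; apply: measurable_funM.
    exact: measurable_fst.
  exact: measurable_snd.
have mabs : measurable_fun setT (fun x : R => `|x|%:E).
  by apply/measurable_EFinP; exact: normr_measurable.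
have abs_lty (Z : {RV P >-> R}) : P.-integrable setT (EFin \o Z) ->
    (\int[distribution P Z]_x `|x|%:E < +oo)%E.
  by move=> /integrableP[_]; rewrite ge0_integral_distribution.
have idist (Z : {RV P >-> R}) : P.-integrable setT (EFin \o Z) ->
    (distribution P Z).-integrable setT EFin.
  by move=> Zi; exact: integrable_pushforward.
have pi : (distribution P X \x distribution P Y)%E.-integrable setT p.
  (* The iterated integral of |xy| is the product of the first absolute moments, both finite. *)
  apply/integrable12ltyP => //.
  under eq_integral => x _.
    under eq_integral => y _ do rewrite /p /= normrM EFinM.
    rewrite ge0_integralZl //.
    over.
  rewrite ge0_integralZr //; last exact: integral_ge0.
  by rewrite lte_mul_pinfty ?integral_ge0 ?ge0_fin_numE ?abs_lty ?integral_ge0.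
have fgi : P.-integrable setT (EFin \o (f \* g)).
  apply/integrableP; split.
    by apply/measurable_EFinP; exact: measurable_funM.
  have /integrableP[_] := pi.
  rewrite (eq_measure_integral (distribution P hM)); last first.
    by move=> A mA _; exact: lawE.
  rewrite ge0_integral_distribution//.
  exact: measurableT_comp.
split => //.
have -> : ('E_P[f \* g] = \int[distribution P hM]_z p z)%E.
  by rewrite integral_distribution// unlock.
rewrite -(eq_measure_integral _
  (m1 := (distribution P X \x distribution P Y)%E)); last first.
  by move=> A mA _; exact: lawE.
rewrite -integral12_prod_meas1// /fubini_F.
have EY : (\int[distribution P Y]_y y%:E = b%:E)%E.
  by rewrite integral_distribution// -Eg unlock.
have EX : (\int[distribution P X]_y y%:E = a%:E)%E.
  by rewrite integral_distribution// -Ef unlock.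
under eq_integral => x _.
  under eq_integral => y _ do rewrite /p /= EFinM.
  rewrite integralZl//; last exact: idist.
  rewrite EY.
  over.
by rewrite integralZr// ?EX//; exact: idist.
Qed.

(* That [f] is a measurable function of the entries of [X] is expressed by
   quantifying over all measurable spaces over [T] making these entries
   measurable; it is then used with [T] carrying the sigma-algebra of [X]. *)
Lemma measurable_sigma_of_mx p q (X : T -> 'M[R]_(p, q)) (f : T -> R) :
  (forall d' (T' : measurableType d') (u : T' -> T),
    (forall i j, measurable_fun setT (fun w => X (u w) i j)) ->
    measurable_fun setT (f \o u)) ->
  forall B, measurable B -> sigma_of_mx X (f @^-1` B).
Proof.
move=> mf B mB.
set gen := [set E | exists (i : 'I_p) (j : 'I_q) (B : set R),
  measurable B /\ E = (fun w => X w i j) @^-1` B].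
suff mfid : measurable_fun [set: g_sigma_algebraType gen] (f \o id).
  by rewrite -[_ @^-1` _]setTI; exact: mfid.
apply: mf => i j _ C mC; rewrite setTI.
by apply: sub_sigma_algebra; exists i, j, C.
Qed.

(** The same device as for [measurable_sigma_of_mx], with T now carrying the sigma-algebra generated
    by [past]. *)
Lemma measurable_past p q (X : nat -> T -> 'M[R]_(p, q)) (t : nat) (f : T -> R) :
  (forall d' (T' : measurableType d') (u : T' -> T),
    (forall s i j, (s < t)%N -> measurable_fun setT (fun w => X s (u w) i j)) ->
    measurable_fun setT (f \o u)) ->
  forall B, measurable B ->
    <<s past (fun s => sigma_of_mx (X s)) t >> (f @^-1` B).
Proof.
move=> mf B mB; pose U := g_sigma_algebraType (past (fun s => sigma_of_mx (X s)) t).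
suff mfid : measurable_fun [set: U] (f \o id).
  by rewrite -[_ @^-1` _]setTI; exact: mfid.
apply: mf => s i j st _ C mC; rewrite setTI.
apply: sub_sigma_algebra; apply: (@sub_past _ s) => //.
  by move=> r; exact: (@measurableT _ (g_sigma_algebraType _)).
by apply: sub_sigma_algebra; exists i, j, C.
Qed.

End Probability.

(** * The closed-loop trajectory and its second moments *)

Lemma measurable_trajectory (R : realType) d (T : measurableType d) n k
    (V : nat -> T -> 'M[R]_(n, k)) (L : 'M[R]_(k, n)) (x0 : 'cV[R]_n)
    (x : nat -> T -> 'cV[R]_n) (t : nat) :
  (forall s i j, (s < t)%N -> measurable_fun setT (fun w => V s w i j)) ->
  (forall w, x 0%N w = x0) ->
  (forall s w, x s.+1 w = V s w *m L *m x s w) ->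
  forall i, measurable_fun setT (fun w => x t w i 0).
Proof.
move=> mV x00 xS; elim: t mV => [|t IH] mV i.
  by under eq_fun do rewrite x00; exact: measurable_cst.
under eq_fun => w.
  rewrite xS mxE.
  under eq_bigr => j _ do rewrite mxE.
  over.
apply: measurable_sum => j; apply: measurable_funM; last first.
  by apply: IH => s i' j' st; apply: mV; exact: ltnW.
apply: measurable_sum => p; apply: measurable_funM; first exact: mV.
exact: measurable_cst.
Qed.

Lemma quadratic_step (R : realType) n k (V : 'M[R]_(n, k)) (L : 'M[R]_(k, n))
    (x : 'cV[R]_n) a b :
  (V *m L *m x) a 0 * (V *m L *m x) b 0 =
  \sum_i \sum_j \sum_p \sum_q L p i * L q j *
    (V a p * V b q * (x i 0 * x j 0)).
Proof.
have mulE c : (V *m L *m x) c 0 = \sum_i (V *m L) c i * x i 0 by rewrite mxE.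
rewrite !mulE big_distrlr; apply: eq_bigr => i _; apply: eq_bigr => j _ /=.
rewrite mulrACA !mxE big_distrlr /= big_distrl; apply: eq_bigr => p _ /=.
rewrite big_distrl /=; apply: eq_bigr => q _ /=.
by rewrite [X in X * _]mulrACA [X in X * _]mulrC -[LHS]mulrA.
Qed.

Theorem theorem1 (R : realType) (d : measure_display) (T : measurableType d)
  (P : probability T R)
  (n m dth N : nat) (Sth : set 'rV[R]_dth) (phi : 'rV[R]_dth -> 'rV[R]_N)
  (Ms : 'I_N -> 'M[R]_((n + m) * n))
  (A : nat -> T -> 'M[R]_n) (B : nat -> T -> 'M[R]_(n, m))
  (K : 'M[R]_(m, n))
  (Ee : 'M[R]_(vech_dim n, n * n)) (D : 'M[R]_(n * n, vech_dim n))
  (x0 : 'cV[R]_n) (th : nat -> 'rV[R]_dth) (x : nat -> T -> 'cV[R]_n)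
  (tht : nat -> 'rV[R]_N) (xt : nat -> 'cV[R]_(vech_dim n)) :
  (* phi : S_theta -> P_N, and the M^(k) are symmetric *)
  (forall z, Sth z -> @simplex R N (phi z)) ->
  (forall k, (Ms k)^T = Ms k) ->
  (* E_e and D *)
  (forall X : 'M[R]_n, Ee *m vec X = vech X) ->
  (forall Y : 'M[R]_n, Y^T = Y -> D *m vech Y = vec Y) ->
  (* the parameter sequence *)
  (forall t, Sth (th t)) ->
  (* P is the conditional law given theta_.: the v_t = vec([A_t, B_t]) are
     measurable and mutually independent *)
  (forall t (i j : 'I_n), measurable_fun setT (fun w => A t w i j)) ->
  (forall t (i : 'I_n) (j : 'I_m), measurable_fun setT (fun w => B t w i j)) ->
  mutually_independent P (fun t => sigma_of_mx (fun w => row_mx (A t w) (B t w))) ->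
  (* SMP: E[v_t v_t^T | theta_.] = sum_k phi(theta_t)_k M^(k) *)
  (forall t (r s : 'I_((n + m) * n)),
      P.-integrable setT (fun w => (vAB (A t w) (B t w) r ord0 * vAB (A t w) (B t w) s ord0)%:E)) ->
  (forall t (r s : 'I_((n + m) * n)),
      ('E_P[(fun w => vAB (A t w) (B t w) r ord0 * vAB (A t w) (B t w) s ord0)%R]
      = ((\sum_(k < N) phi (th t) ord0 k *: Ms k)%R r s)%:E)%E) ->
  (* closed loop with deterministic initial state x0 *)
  (forall w, x 0%N w = x0) ->
  (forall t w, x t.+1 w = (A t w - B t w *m K) *m x t w) ->
  (* expanded system *)
  xt 0%N = vech (x0 *m x0^T) ->
  (forall t, tht t = phi (th t)) ->
  (forall t, xt t.+1 = Cmap Ee D (Fth Ms (tht t) K) *m xt t) ->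
  forall t (k : 'I_(vech_dim n)),
    ('E_P[(fun w => vech (x t w *m (x t w)^T) k ord0)%R] = (xt t k ord0)%:E)%E.
Proof.
move=> _ _ EeE DE _ _ _ ind VVi VVE x00 xS xt0 thtE xtS.
pose V t w := row_mx (A t w) (B t w); pose L := loop_mx K.
have {}xS t w : x t.+1 w = V t w *m L *m x t w by rewrite xS loop_mxE.
(* Column stacking puts the entry (a, p) of V_t at position [mxvec_index p a] of v_t. *)
have VV t a p b q : has_mean P (fun w => V t w a p * V t w b q)
    ((\sum_k phi (th t) 0 k *: Ms k) (mxvec_index p a) (mxvec_index q b)).
  split; last rewrite -VVE; last congr ('E_P[_])%E.
    apply: (eq_integrable _ _ _ _ (VVi t (mxvec_index p a) (mxvec_index q b))) => //.
    by move=> w _; rewrite /vAB !vec_index.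
  by apply/funext => w; rewrite /vAB !vec_index.
(* The induction carries the full second moment matrix S, since the recursion involves all its
   entries. *)
have invariant t : exists2 S : 'M[R]_n, xt t = vech S &
    forall i j, has_mean P (fun w => x t w i 0 * x t w j 0) (S i j).
  elim: t => [|t [S xtE xxE]].
    exists (x0 *m x0^T) => // i j.
    under eq_fun do rewrite x00.
    by rewrite !mxE big_ord1 !mxE; exact: has_mean_cst.
  pose S' := \matrix_(a, b) \sum_i \sum_j \sum_p \sum_q L p i * L q j *
    ((\sum_k phi (th t) 0 k *: Ms k) (mxvec_index p a) (mxvec_index q b) * S i j).
  (* Symmetry of S gives [D *m vech S = vec S]; it follows from commutativity and uniqueness of the
     mean. *)
  have SS : S^T = S.
    apply/matrixP => i j; rewrite mxE; apply: (has_mean_unique (xxE j i)).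
    by under eq_fun do rewrite mulrC; exact: xxE.
  exists S'.
    (* With [vech S'] written as [Ee *m vec S'], the factor [Ee] cancels and an identity between
       [vec] columns remains. *)
    rewrite xtS xtE /Cmap -mulmxA DE// -mulmxA -EeE; congr (_ *m _).
    by apply: vecP => a b; rewrite Fth_vec_index vec_index mxE thtE.
  move=> a b; rewrite mxE.
  under eq_fun => w do rewrite xS quadratic_step.
  apply: has_mean_sum => i; apply: has_mean_sum => j.
  apply: has_mean_sum => p; apply: has_mean_sum => q; apply: has_meanZ.
  apply: has_mean_mul (VV t a p b q) (xxE i j) => B1 B2 mB1 mB2.
  rewrite setIC muleC; apply: (past_independent _ _ ind (t := t)).
  - by move=> s; exact: (@measurableT _ (g_sigma_algebraType _)).
  - by move=> s C C'; exact: (@measurableI _ (g_sigma_algebraType _)).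
  - apply: measurable_past mB2 => d' T' u mV.
    (* The trajectory is read on T' through u, where only the V_s with s < t are known to be
       measurable; these determine x_t. *)
    have mx := @measurable_trajectory _ _ T' _ _ (fun s w => V s (u w)) L x0
      (fun s w => x s (u w)) t mV.
    by apply: measurable_funM; apply: mx.
  - apply: measurable_sigma_of_mx mB1 => d' T' u mV.
    by apply: measurable_funM; apply: mV.
move=> t k; have [S -> xxE] := invariant t.
(* [Ee] exhibits each entry of [vech] as a fixed linear combination of matrix entries, so linearity
   of the mean applies without unfolding [vech]. *)
have vechE (X : 'M[R]_n) : vech X k 0 =
    \sum_j \sum_i Ee k (mxvec_index j i) * X i j.
  rewrite -EeE mxE sum_mxvec_index.
  by apply: eq_bigr => j _; apply: eq_bigr => i _; rewrite vec_index.
suff [] : has_mean P (fun w => vech (x t w *m (x t w)^T) k 0) (vech S k 0) by [].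
rewrite vechE; under eq_fun do rewrite vechE.
apply: has_mean_sum => j; apply: has_mean_sum => i; apply: has_meanZ.
by under eq_fun do rewrite mxE big_ord1 mxE; exact: xxE.
Qed.
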